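(* Let $n\ge 21$ be an integer and let $G$ be a connected, non-complete graph of order $n$ with $\delta(G)\ge 3$. If $C(G)$ is a linear forest and $\sigma_4(G)\ge \frac{4n-19}{5}$, then $cfc(G)=2$.
   Context: All graphs are finite, without loops or multiple edges; the order of $G$ is $|V(G)|$, $d_G(v)$ is the degree of $v$ in $G$, and $\delta(G)$ is the minimum degree of $G$. $\sigma_4(G)$ is the minimum of $\sum_{s\in S} d_G(s)$ over all independent sets $S\subseteq V(G)$ (no two vertices adjacent) with $|S|=4$; by convention $\sigma_4(G)=+\infty$ if $G$ has no independent set of size $4$. A cut-edge of a connected graph is an edge whose deletion increases the number of components. $C(G)$ denotes the subgraph of $G$ formed (induced) by the cut-edges of $G$; it is a linear forest if each of its components is a path (the case of no cut-edges, i.e. zero components, is included). Given an edge-colouring of $G$ (not necessarily proper), a path is conflict-free if some colour appears on exactly one of its edges. An edge-coloured graph is conflict-free connected if every pair of distinct vertices is connected by a conflict-free path. The conflict-free connection number $cfc(G)$ of a connected graph $G$ is the minimum number of colours in an edge-colouring making $G$ conflict-free connected. *)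

(* Defs.v *)
(* A finite simple graph is a symmetric irreflexive relation e on a finType V. *)
From HB Require Import structures.
From mathcomp Require Import all_boot all_order all_algebra.
From mathcomp Require Import constructive_ereal.

Set Implicit Arguments.
Unset Strict Implicit.
Unset Printing Implicit Defensive.

Section Graph.
Variables (V : finType) (e : rel V).

Definition edges : {set {set V}} := [set [set a.1; a.2] | a : V * V & e a.1 a.2].

Definition connected : Prop := forall x y : V, connect e x y.

Definition complete : Prop := forall x y : V, x != y -> e x y.

Definition deg (v : V) : nat := #|[set w | e v w]|.

(* Every degree is below #|V|, so the default #|V| is never attained when V is
   nonempty. *)
Definition min_deg : nat := \big[minn/#|V|]_(v : V) deg v.

Definition independent (S : {set V}) : bool :=
  [forall x in S, forall y in S, ~~ e x y].

Definition sigma (k : nat) : \bar rat :=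
  (\big[Order.min/+oo]_(S : {set V} | independent S && (#|S| == k))
     ((\sum_(s in S) deg s)%N%:R : rat)%:E)%E.

Definition del_edge (f : {set V}) : rel V :=
  [rel x y | e x y && ([set x; y] != f)].

Definition cut_edges : {set {set V}} :=
  [set f in edges | n_comp e V < n_comp (del_edge f) V].

(* The subgraph C(G) formed by the cut-edges has vertex set cut_verts and
   adjacency cut_adj. *)
Definition cut_verts : {set V} := cover cut_edges.
Definition cut_adj : rel V := [rel x y | [set x; y] \in cut_edges].

End Graph.

(* The edges, in order, of the walk that visits x and then the vertices of p. *)
Definition walk_edges (V : finType) (x : V) (p : seq V) : seq {set V} :=
  pairmap (fun a b => [set a; b]) x p.

(* Every component of the graph with vertex set D and adjacency h is a path:
   its vertices are those of a repetition-free sequence x :: p, and its edges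
   are exactly the pairs of consecutive vertices of that sequence. *)
Definition linear_forest (V : finType) (D : {set V}) (h : rel V) : Prop :=
  forall v : V, v \in D ->
  exists (x : V) (p : seq V),
    [/\ uniq (x :: p),
        (forall w, (w \in x :: p) = connect h v w)
      & {in x :: p &, forall a b, h a b = ([set a; b] \in walk_edges x p)}].

Definition conflict_free (V : finType) (c : {set V} -> nat)
    (x : V) (p : seq V) : Prop :=
  exists i : nat, count_mem i [seq c f | f <- walk_edges x p] = 1%N.

Definition cf_connected (V : finType) (e : rel V) (c : {set V} -> nat) : Prop :=
  forall x y : V, x != y ->
  exists p : seq V,
    [/\ path e x p, last x p = y, uniq (x :: p) & conflict_free c x p].

(* Only the values of c on the edges matter; the colours are 0, ..., k - 1. *)
Definition cf_colourable (V : finType) (e : rel V) (k : nat) : Prop :=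
  exists c : {set V} -> nat,
    {in edges e, forall f, c f < k} /\ cf_connected e c.

(* cfc e k says that the conflict-free connection number of the graph is k. *)
Definition cfc (V : finType) (e : rel V) (k : nat) : Prop :=
  cf_colourable e k /\ forall j : nat, cf_colourable e j -> k <= j.

(* Main.v *)
(* Let C be the set of cut-edges and H = G - C. Colour a spanning tree T of G
   with 0 and the other edges with 1, recolouring one cut-edge f0 with 1. This
   works as soon as f0 belongs to every pair of adjacent cut-edges: if x and y
   are not separated by f0 and their tree path contains a non-cut edge f, some
   non-tree edge g joins the two sides of T - f, and the path through g has
   colour 1 exactly once.

   Call a component of H uncut if it has a vertex on no cut-edge. Vertices of
   this kind from distinct components are independent and the degree of each is
   below the size of its component, so the degree sum condition allows at most 4
   uncut components. Let W be the set of vertices on two cut-edges. In each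
   component the number of incidences with cut-edges exceeds the number of its
   vertices in W by at least 1 if it is uncut, and by at least 3 otherwise. As H
   has more than |C| components, |W| + |C| <= 5; also |W| <= |C|. Hence |W| <= 2,
   and if |W| = 2 then |C| <= 3 and the two vertices share a cut-edge f0. *)
Require Import Defs.
From HB Require Import structures.
From mathcomp Require Import all_boot all_order all_algebra.
From mathcomp Require Import constructive_ereal.
From mathcomp Require Import zify.

Set Implicit Arguments.
Unset Strict Implicit.
Unset Printing Implicit Defensive.

(** * Walks, connectivity and component counts of graphs given by edge sets *)

Section EdgeSets.
Variable V : finType.
Implicit Types (F : {set {set V}}) (f : {set V}) (x y u v : V) (p : seq V).

Lemma set2_eq x y u v : [set x; y] = [set u; v] ->
  x = u /\ y = v \/ x = v /\ y = u.
Proof.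
move=> E.
have /set2P hx : x \in [set u; v] by rewrite -E set21.
have /set2P hy : y \in [set u; v] by rewrite -E set22.
have /set2P hu : u \in [set x; y] by rewrite E set21.
have /set2P hv : v \in [set x; y] by rewrite E set22.
by case: hx => hx; case: hy => hy; case: hu => hu; case: hv => hv; subst; auto.
Qed.

(** Spanning subgraphs are encoded by their edge sets, so that deleting edges is a set
    difference. *)
Definition adj F : rel V := [rel x y | [set x; y] \in F].

Lemma adj_sym F : symmetric (adj F).
Proof. by move=> x y; rewrite /adj /= setUC. Qed.

Lemma adj_csym F : connect_sym (adj F).
Proof. exact/sym_connect_sym/adj_sym. Qed.

Lemma connectS F1 F2 x y :
  F1 \subset F2 -> connect (adj F1) x y -> connect (adj F2) x y.
Proof.
by move=> /subsetP sF; apply: connect_sub => a b /sF ab; apply: connect1.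
Qed.

Lemma walk_edges_cat x p1 p2 :
  walk_edges x (p1 ++ p2) = walk_edges x p1 ++ walk_edges (last x p1) p2.
Proof. exact: pairmap_cat. Qed.

Lemma path_adj F x p : path (adj F) x p = all [in F] (walk_edges x p).
Proof. by elim: p x => //= y p IHp x; rewrite IHp. Qed.

Lemma walk_edges_sub x p f z : f \in walk_edges x p -> z \in f -> z \in x :: p.
Proof.
elim: p x => //= y p IHp x /predU1P[-> | /IHp sub /sub] zf; last first.
  by rewrite inE zf orbT.
by move: zf; rewrite !inE orbA => ->.
Qed.

Lemma walk_edges_uniq x p : uniq (x :: p) -> uniq (walk_edges x p).
Proof.
elim: p x => //= y p IHp x /andP[xNp /IHp ->]; rewrite andbT.
by apply: contra xNp => /walk_edges_sub-> //; rewrite !inE eqxx.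
Qed.

Lemma walk_edges_split x p f : f \in walk_edges x p -> uniq (x :: p) ->
  exists b p1 p2, [/\ p = p1 ++ b :: p2, f = [set last x p1; b],
    f \notin walk_edges x p1 & f \notin walk_edges b p2].
Proof.
move=> fp /walk_edges_uniq; elim: p x fp => //= y p IHp x.
have [-> _ /andP[xyNp _] | fNxy] := eqVneq f [set x; y].
  by exists y, [::], p.
rewrite inE (negPf fNxy) /= => fp /andP[_ yp].
have [b [p1 [p2 [-> fE N1 N2]]]] := IHp y fp yp.
by exists b, (y :: p1), p2; split=> //=; rewrite inE negb_or fNxy.
Qed.

Lemma connect_walk F x p :
  {subset walk_edges x p <= F} -> connect (adj F) x (last x p).
Proof. by move=> /allP; rewrite -path_adj => pF; apply/connectP; exists p. Qed.

Lemma connect_upath F x y : connect (adj F) x y ->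
  exists p, [/\ path (adj F) x p, uniq (x :: p) & last x p = y].
Proof. by case/connectP => p /shortenP[q qF qU _] ->; exists q. Qed.

Lemma connect_del1 F u v : connect (adj (F :\ [set u; v])) u v ->
  connect (adj (F :\ [set u; v])) =2 connect (adj F).
Proof.
move=> uv x y; apply/idP/idP; first exact/connectS/subsetDl.
apply: connect_sub => a b abF.
have [abE | abN] := eqVneq [set a; b] [set u; v]; last first.
  by apply: connect1; rewrite /adj /= in_setD1 abN.
by case: (set2_eq abE) => -[-> ->] //; rewrite adj_csym.
Qed.

(** Follow a simple path from [x] to [y] up to the edge [uv], if it occurs: this initial piece
    avoids the edge and ends at [u] or [v]. *)
Lemma connect_del F u v x y : connect (adj F) x y ->
  [|| connect (adj (F :\ [set u; v])) x y,
      connect (adj (F :\ [set u; v])) x u |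
      connect (adj (F :\ [set u; v])) x v].
Proof.
case/connect_upath => p; rewrite path_adj => -[/allP pF pU <-].
have [uvp | uvNp] := boolP ([set u; v] \in walk_edges x p); last first.
  rewrite connect_walk // => f fp; rewrite in_setD1 pF // andbT.
  by apply: contraNneq uvNp => <-.
have [b [p1 [p2 [pE uvE N1 _]]]] := walk_edges_split uvp pU.
have : connect (adj (F :\ [set u; v])) x (last x p1).
  rewrite connect_walk // => f fp; rewrite in_setD1 pF ?andbT.
    by apply: contraNneq N1 => <-.
  by rewrite pE walk_edges_cat mem_cat fp.
have: last x p1 \in [set u; v] by rewrite uvE !inE eqxx.
by rewrite !inE => /orP[] /eqP-> ->; rewrite !orbT.
Qed.

Lemma n_comp_gt0 F x : 0 < n_comp (adj F) V.
Proof.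
apply/card_gt0P; exists (fingraph.root (adj F) x).
by rewrite !inE andbT; apply/roots_root/adj_csym.
Qed.

(** Sending each [h2]-component to the [h1]-component of its root is injective; the [h2]-component
    of [u] splits, so it contains an [h1]-component that is missed. *)
Lemma n_comp_lt (h1 h2 : rel V) u v : connect_sym h1 -> connect_sym h2 ->
    (forall x y, connect h1 x y -> connect h2 x y) ->
    connect h2 u v -> ~~ connect h1 u v ->
  n_comp h2 V < n_comp h1 V.
Proof.
move=> sym1 sym2 sub12 uv2 uvN1.
have root12 x y : connect h1 x y -> fingraph.root h2 x = fingraph.root h2 y.
  by move=> /sub12 xy; apply/eqP; rewrite root_connect.
pose A := predI (roots h2) (mem V).
have injA : {in A &, injective (fingraph.root h1)}.
  move=> x y /andP[/eqP rx _] /andP[/eqP ry _] /eqP.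
  by rewrite root_connect // => /root12; rewrite rx ry.
rewrite {1}/n_comp_mem -/A -(card_in_image injA); apply: proper_card.
apply/properP; split.
  by apply/subsetP => _ /imageP[x _ ->]; rewrite !inE andbT roots_root.
have [w [uw wN]] : exists w, connect h2 u w /\
    ~~ connect h1 w (fingraph.root h2 u).
  case: (boolP (connect h1 u (fingraph.root h2 u))) => [uw | ?]; last by exists u.
  by exists v; split=> //; apply: contra uvN1 => vw;
     rewrite (connect_trans uw) // sym1.
exists (fingraph.root h1 w); first by rewrite !inE andbT roots_root.
apply/imageP => -[x /andP[/eqP rx _]] /eqP; rewrite root_connect // => wx.
case/negP: wN; suff -> : fingraph.root h2 u = x by [].
by rewrite -rx -(root12 _ _ wx); apply/eqP; rewrite root_connect.
Qed.

End EdgeSets.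

(** * Cut-edges as bridges of a connected graph *)

Section CutEdges.
Variables (V : finType) (e : rel V).
Hypotheses (e_sym : symmetric e) (e_irr : irreflexive e) (e_conn : connected e).
Implicit Types (F : {set {set V}}) (f : {set V}) (x y u v : V) (p : seq V).

Lemma mem_edges x y : ([set x; y] \in edges e) = e x y.
Proof.
apply/imsetP/idP => [[[a b]] | xy]; last by exists (x, y); rewrite ?inE.
by rewrite inE /= => ab /set2_eq[] [-> ->] //; rewrite e_sym.
Qed.

Lemma edgeE f : f \in edges e -> exists x y, e x y /\ f = [set x; y].
Proof. by case/imsetP => -[x y]; rewrite inE => xy ->; exists x, y. Qed.

Lemma card_edge f : f \in edges e -> #|f| = 2.
Proof.
case/edgeE => x [y [xy ->]]; rewrite cards2; case: eqP xy => // ->.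
by rewrite e_irr.
Qed.

Lemma adj_edges : adj (edges e) =2 e.
Proof. exact: mem_edges. Qed.

Lemma del_edgeE f : del_edge e f =2 adj (edges e :\ f).
Proof. by move=> x y; rewrite /del_edge /adj /= in_setD1 mem_edges andbC. Qed.

Lemma connect_edges x y : connect (adj (edges e)) x y.
Proof. by rewrite (eq_connect adj_edges). Qed.

Lemma cut_edges_sub : cut_edges e \subset edges e.
Proof. by apply/subsetP => f; rewrite inE => /andP[]. Qed.

Lemma mem_cut u v : e u v ->
  ([set u; v] \in cut_edges e) = ~~ connect (adj (edges e :\ [set u; v])) u v.
Proof.
move=> uv; rewrite inE mem_edges uv /=.
rewrite (eq_n_comp (eq_connect (del_edgeE _))) -(eq_n_comp (eq_connect adj_edges)).
apply/idP/idP => [|uvN].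
  by apply: contraTN => /connect_del1/eq_n_comp->; rewrite ltnn.
apply: (n_comp_lt (adj_csym _) (adj_csym _) _ _ uvN).
  by move=> x y; apply/connectS/subsetDl.
exact: connect_edges.
Qed.

(** Otherwise the pieces of the path before and after [f], with the connection between its ends,
    join the ends of [f] off [f]. *)
Lemma cut_off_upath f x p : f \in cut_edges e -> path e x p -> uniq (x :: p) ->
  connect (adj (edges e :\ f)) x (last x p) -> f \notin walk_edges x p.
Proof.
move=> fC pE pU xy; apply/negP => fp.
have [b [p1 [p2 [pEq fE N1 N2]]]] := walk_edges_split fp pU.
move: (fC); rewrite fE mem_cut -?fE; last first.
  by rewrite -mem_edges -fE (subsetP cut_edges_sub).
case/negP; move: pE; rewrite -(eq_path adj_edges) path_adj => /allP pE.
have x1 : connect (adj (edges e :\ f)) x (last x p1).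
  rewrite connect_walk // => g gp; rewrite in_setD1 pE ?andbT.
    by apply: contraNneq N1 => <-.
  by rewrite pEq walk_edges_cat mem_cat gp.
have b2 : connect (adj (edges e :\ f)) b (last x p).
  rewrite pEq last_cat connect_walk // => g gp; rewrite in_setD1 pE ?andbT.
    by apply: contraNneq N2 => <-.
  by rewrite pEq walk_edges_cat mem_cat /= inE gp !orbT.
by rewrite adj_csym (connect_trans _ x1) // adj_csym (connect_trans xy) // adj_csym.
Qed.

(* A non-cut edge lies on a cycle, and no edge of a cycle is a cut-edge. *)
Lemma connect_noncut u v : e u v -> [set u; v] \notin cut_edges e ->
  connect (adj ((edges e :\: cut_edges e) :\ [set u; v])) u v.
Proof.
move=> uv uvN; move: (uvN); rewrite mem_cut // negbK => /connect_upath.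
case=> p [pE pU lp]; rewrite -[X in connect _ _ X]lp; apply: connect_walk => f fp.
move: (pE); rewrite path_adj => /allP/(_ _ fp).
rewrite in_setD1 => /andP[fuv fE]; rewrite in_setD1 fuv in_setD fE andbT /=.
(* The edge [uv] joins the ends of the detour without [f], so the detour cannot cross the bridge
   [f]. *)
apply/negP => fC; have /negP[] // : f \notin walk_edges u p.
apply: (cut_off_upath fC _ pU).
  by rewrite -(eq_path adj_edges); apply: sub_path pE => a b /setD1P[].
by rewrite lp connect1 // /adj /= in_setD1 eq_sym fuv mem_edges.
Qed.

(** Induct on the size of [A]: restoring one edge of [A] merges two components, since a bridge
    separates its ends in every subgraph that lacks it. *)
Lemma card_cut_lt (x0 : V) (A : {set {set V}}) : A \subset cut_edges e ->
  #|A| < n_comp (adj (edges e :\: A)) V.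
Proof.
have [m] := ubnP #|A|; elim: m A => // m IHm A Am AC.
have [-> | [f fA]] := set_0Vmem A.
  by rewrite cards0; apply: (n_comp_gt0 _ x0).
have fC := subsetP AC f fA; have fE := subsetP cut_edges_sub f fC.
have AfC : A :\ f \subset cut_edges e := subset_trans (subsetDl _ _) AC.
move: Am; rewrite (cardsD1 f) fA ltnS add1n => Am.
have [a [b [ab fab]]] := edgeE fE.
apply: (leq_ltn_trans (IHm _ Am AfC)); apply: (@n_comp_lt _ _ _ a b).
- exact: adj_csym.
- exact: adj_csym.
- move=> x y; apply/connectS/subsetP => g; rewrite !in_setD.
  by case: (g \in A); rewrite ?andbF.
- by apply: connect1; rewrite /adj /= -fab !inE eqxx.
move: (fC); rewrite fab mem_cut // -fab; apply: contra.
by apply/connectS/subsetP => g; rewrite !in_setD in_set1 => /andP[gA ->];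
   rewrite andbT; apply: contraNneq gA => ->.
Qed.

(** * Cut-edges at a vertex *)

Definition cut_at v : {set {set V}} := [set f in cut_edges e | v \in f].

Lemma cut_at_le2 v : linear_forest (cut_verts e) (cut_adj e) ->
  #|cut_at v| <= 2.
Proof.
move=> lin; case: (set_0Vmem (cut_at v)) => [-> | [f0]]; first by rewrite cards0.
rewrite inE => /andP[f0C vf0].
have [|x [p [Up conn hE]]] := lin v; first by apply/bigcupP; exists f0.
have vp : v \in x :: p by rewrite conn.
pose s w := nth x (x :: p) w.
pose i := index v (x :: p).
(* Cut-edges at [v] lead to its neighbours in the sequence. At an end of the sequence one of these
   two sets is a dummy, harmless for an upper bound. *)
apply: (@leq_trans #|[set [set v; s i.+1]; [set v; s i.-1]]|); last first.
  by rewrite cards2; case: eqP.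
apply/subset_leq_card/subsetP => f; rewrite inE => /andP[fC vf].
have [a [b [ab fE]]] := edgeE (subsetP cut_edges_sub f fC).
have [w fvw] : exists w, f = [set v; w].
  move: vf; rewrite fE => /set2P[]->; first by exists b.
  by exists a; rewrite setUC.
have vw : cut_adj e v w by rewrite /cut_adj /= -fvw.
have wp : w \in x :: p by rewrite conn connect1.
move: vw; rewrite hE // => vwp.
have [c [p1 [p2 [pE vwE _ _]]]] := walk_edges_split vwp Up.
have sp k : k = size p1 -> s k = last x p1 /\ s k.+1 = c.
  move=> ->; split; first by rewrite /s pE -cat_cons nth_cat /= leqnn -last_nth.
  by rewrite /s pE /= nth_cat ltnn subnn.
have [s1 s2] := sp _ erefl.
have si k : k < size (x :: p) -> s k = v -> i = k.
  by rewrite /i => kp <-; rewrite index_uniq.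
have sz : size p1 < size p by rewrite pE size_cat /= addnS ltnS leq_addr.
rewrite fvw; case: (set2_eq vwE) => -[vE ->].
  by rewrite (si (size p1)) ?s1 ?s2 ?inE ?eqxx // ltnW.
by rewrite (si (size p1).+1) /= ?s1 ?s2 ?inE ?eqxx ?orbT.
Qed.

Lemma sum_cut_at : \sum_v #|cut_at v| = 2 * #|cut_edges e|.
Proof.
under eq_bigr => v _ do rewrite -sum1dep_card big_mkcondr /=.
rewrite exchange_big /= mulnC -sum_nat_const; apply: eq_bigr => f fC.
by rewrite -big_mkcond sum1_card card_edge // (subsetP cut_edges_sub).
Qed.

(** * The colouring from a spanning tree *)

Lemma connect_crossing (h : rel V) (X : pred V) x y :
  connect h x y -> X x -> ~~ X y -> exists s t, [/\ h s t, X s & ~~ X t].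
Proof.
case/connectP => p + ->; elim: p x => [|z p IHp] x /=; first by move=> _ ->.
case/andP=> xz pz Xx; have [Xz | XNz _] := boolP (X z); first exact: IHp.
by exists x, z.
Qed.

(* If no two cut-edges are adjacent, f0 can be any set that is not an edge. The
   path rerouted through a non-tree edge avoids f0: a simple path crosses a
   bridge at most once, and the tree path, with the same ends, does not. *)
Lemma cf_colourable2 (f0 : {set V}) :
    (f0 \in edges e -> f0 \in cut_edges e) ->
    (forall f g w, f \in cut_at w -> g \in cut_at w -> f != g ->
       f0 \in [set f; g]) ->
  cf_colourable e 2.
Proof.
move=> f0C f0_hits.
pose spanning (T : {set {set V}}) :=
  (T \subset edges e) && [forall x, forall y, connect (adj T) x y].
(* A spanning tree is obtained as a minimal connected spanning edge set; minimality makes each of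
   its edges a bridge of [T]. *)
have [|T] := @ex_minset _ spanning.
  exists (edges e); rewrite /spanning subxx.
  by apply/forallP => x; apply/forallP => y; apply: connect_edges.
case/minsetP => /andP[TE /forallP Tconn] Tmin.
have{} Tconn x y : connect (adj T) x y by have /forallP := Tconn x.
have{} Tmin u v : [set u; v] \in T -> ~~ connect (adj (T :\ [set u; v])) u v.
  move=> uvT; apply/negP => uv.
  have /setP/(_ [set u; v]) : T :\ [set u; v] = T; last first.
    by rewrite !inE eqxx uvT.
  apply: Tmin (subsetDl _ _); rewrite /spanning (subset_trans (subsetDl _ _) TE).
  by apply/forallP => x; apply/forallP => y; rewrite connect_del1.
have pathE F p x : F \subset edges e -> path (adj F) x p -> path e x p.
  move=> /subsetP sF; rewrite -(eq_path adj_edges).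
  by apply: sub_path => a b /sF.
pose c f : nat := (f \notin T) || (f == f0).
exists c; split=> [f _ | x y xNy]; first by rewrite /c; case: (_ || _).
have [p [pT pU lp]] := connect_upath (Tconn x y).
have pe := pathE _ _ _ TE pT; move: pT; rewrite path_adj => /allP pT.
(* On a tree path only [f0] can have colour 1. *)
have [f0p | f0Np] := boolP (f0 \in walk_edges x p).
  exists p; split=> //; exists 1; rewrite count_map.
  rewrite (@eq_in_count _ _ (pred1 f0)) => [|f /pT fT].
    by rewrite count_uniq_mem ?f0p ?walk_edges_uniq.
  by rewrite /= /c fT /=; case: (f == f0).
(* A path of cut-edges that avoids [f0] is a single edge: of two consecutive ones, [f0] would be
   one. *)
have [pC | /allPn[f fp fNC]] := boolP (all [in cut_edges e] (walk_edges x p)).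
  exists p; split=> //; case: p lp pU {pT pe} f0Np pC => [|a [|b p]] /=.
  - by move=> xy; case/eqP: xNy.
  - by exists (c [set x; a]); rewrite /= eqxx.
  rewrite !inE !negb_or => _ /andP[/and3P[xa xb _] _] /and3P[f0xa f0ab _].
  case/and3P=> xaC abC _; have: f0 \in [set [set x; a]; [set a; b]].
    apply: (f0_hits _ _ a); rewrite ?inE ?xaC ?abC ?eqxx ?orbT //.
    apply: contraNneq xb => xaab; have := set21 x a.
    by rewrite xaab !inE (negPf xa).
  by rewrite !inE (negPf f0xa) (negPf f0ab).
have [v [p1 [p2 [pEq fE N1 N2]]]] := walk_edges_split fp pU.
set u := last x p1 in fE.
have fT := pT f fp.
have xu : connect (adj (T :\ f)) x u.
  rewrite connect_walk // => g gp; rewrite in_setD1 pT ?andbT.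
    by apply: contraNneq N1 => <-.
  by rewrite pEq walk_edges_cat mem_cat gp.
have vy : connect (adj (T :\ f)) v y.
  rewrite -lp pEq last_cat connect_walk // => g gp; rewrite in_setD1 pT ?andbT.
    by apply: contraNneq N2 => <-.
  by rewrite pEq walk_edges_cat mem_cat /= inE gp !orbT.
have uNv : ~~ connect (adj (T :\ f)) u v by rewrite fE Tmin // -fE.
(* The side of [x] in [T - f]. As [f] is not a cut-edge, some other edge [st] leaves it, necessarily
   outside [T]. *)
pose X := connect (adj (T :\ f)) x.
have XNy : ~~ X y.
  apply: contra uNv => xy; rewrite adj_csym in xu; apply: connect_trans xu _.
  by rewrite adj_csym in vy; apply: connect_trans vy.
have euv : e u v by rewrite -mem_edges -fE (subsetP TE).
have exy : connect (adj (edges e :\ f)) x y.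
  rewrite fE connect_del1 ?connect_edges //.
  by move: fNC; rewrite fE mem_cut // negbK.
have [s [t [st Xs XNt]]] := connect_crossing exy (connect0 _ _) XNy.
have [stf stE] := setD1P st.
have stNT : [set s; t] \notin T.
  apply: contra XNt => stT; apply: connect_trans Xs (connect1 _).
  by rewrite /adj /= in_setD1 stf.
(* [T - f] has only the sides of [u] and [v], and [t] is not on that of [u]. *)
have ty : connect (adj (T :\ f)) t y.
  have tNu : ~~ connect (adj (T :\ f)) t u.
    by apply: contra XNt => tu; apply: connect_trans xu _; rewrite adj_csym.
  have := connect_del u v (Tconn t u); rewrite -fE (negPf tNu) /= => tv.
  exact: connect_trans tv vy.
have [q1 [q1T q1U lq1]] := connect_upath Xs.
have [q2 [q2T q2U lq2]] := connect_upath ty.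
pose q := q1 ++ t :: q2.
have qe : path e x q.
  rewrite cat_path /= lq1 -mem_edges stE.
  by rewrite !(pathE (T :\ f)) // (subset_trans (subsetDl _ _)).
(* The two pieces lie on different sides of [T - f]. *)
have qU : uniq (x :: q).
  rewrite -cat_cons cat_uniq q1U q2U andbT.
  apply/hasPn => z z2; apply: contra XNt => z1.
  apply: connect_trans (path_connect q1T z1) _.
  by rewrite adj_csym (path_connect q2T).
have lq : last x q = y by rewrite last_cat.
have f0Nq : f0 \notin walk_edges x q.
  have [/f0C f0C' | f0NE] := boolP (f0 \in edges e).
    apply: cut_off_upath => //; rewrite lq -lp; apply: connect_walk => g gp.
    rewrite in_setD1 (subsetP TE) ?pT // andbT.
    by apply: contraNneq f0Np => <-.
  apply: contra f0NE; move: qe; rewrite -(eq_path adj_edges) path_adj.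
  by move/allP; apply.
exists q; split=> //; exists 1.
move: f0Nq; rewrite walk_edges_cat /= lq1 map_cat count_cat /= mem_cat inE.
rewrite !negb_or => /and3P[f0q1 _ f0q2].
have none r z : path (adj (T :\ f)) z r -> f0 \notin walk_edges z r ->
    count_mem 1 [seq c g | g <- walk_edges z r] = 0.
  rewrite path_adj => /allP rT f0r; apply/eqP; rewrite -leqn0 leqNgt -has_count.
  apply/hasPn => _ /mapP[g gr ->]; have /setD1P[_ gT] := rT _ gr.
  have /negPf gf0 : g != f0 by apply: contraNneq f0r => <-.
  by rewrite /= /c gT gf0.
by rewrite !none // /c stNT.
Qed.

(** With a single colour, a conflict-free path has exactly one edge, so distinct vertices would be
    adjacent. *)
Lemma cfc_ge2 j : ~ complete e -> cf_colourable e j -> 2 <= j.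
Proof.
move=> ncomp [c [c_lt c_conn]]; rewrite leqNgt; apply/negP => j1.
apply: ncomp => x y /c_conn[p [pe <- _ [i]]].
have c0 : {in walk_edges x p, c =1 fun=> 0}.
  move: pe; rewrite -(eq_path adj_edges) path_adj => /allP pE f /pE /c_lt cf.
  by apply/eqP; rewrite -leqn0 -ltnS (leq_trans cf).
move/eq_in_map: c0 => ->.
case: p pe => [|a [|b p]] //=; first by case/andP.
by case: i => [|i] _ //=; elim: (walk_edges b p).
Qed.

(** * Components of the graph without its cut-edges *)

Let H := adj (edges e :\: cut_edges e).
Let rt := fingraph.root H.

Lemma root_noncut x y : e x y -> [set x; y] \notin cut_edges e -> rt x = rt y.
Proof.
move=> xy xyN; apply/eqP; rewrite root_connect; last exact: adj_csym.
by apply: connect1; rewrite /H /adj /= in_setD xyN mem_edges.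
Qed.

(** All neighbours of [v] lie in its component, which also contains [v] itself. *)
Lemma deg_uncut v : cut_at v = set0 -> deg e v < #|[set w | rt w == rt v]|.
Proof.
move=> v0; apply: proper_card; apply/properP; split; last first.
  by exists v; rewrite !inE // e_irr.
apply/subsetP => w; rewrite !inE => vw; rewrite (root_noncut vw) //.
by apply/negP => vwC; have := in_set0 [set v; w]; rewrite -v0 inE vwC set21.
Qed.

Lemma noncut_nbr v : #|cut_at v| < deg e v ->
  exists2 u, e v u & [set v; u] \notin cut_edges e.
Proof.
rewrite ltnNge => vlt; apply/exists_inP; apply: contraR vlt.
move/exists_inPn => allC.
have inj : {in [set w | e v w] &, injective (fun w => [set v; w])}.
  by move=> a b _ _ /set2_eq[[_ ->] | [<- ->]].
rewrite /deg -(card_in_imset inj); apply/subset_leq_card.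
by apply/subsetP => _ /imsetP[w + ->]; rewrite inE => /allC;
   rewrite negbK [_ \in cut_at v]inE set21 => ->.
Qed.

(** A non-cut edge at [v] lies on a cycle of [H], which has at least three vertices. *)
Lemma comp_card_ge3 v : #|cut_at v| < deg e v -> 3 <= #|[set w | rt w == rt v]|.
Proof.
case/noncut_nbr => u vu vuN.
have [[|w p] []/=] := connect_upath (connect_noncut vu vuN).
  by move=> _ _ vu'; rewrite vu' e_irr in vu.
case/andP; rewrite /adj /= in_setD1 in_setD mem_edges => /and3P[vwvu vwN vw] _.
have uw : u != w by apply: contra_neq vwvu => ->.
have vNu : v != u by apply: contraTneq vu => ->; rewrite e_irr.
have vNw : v != w by apply: contraTneq vw => ->; rewrite e_irr.
rewrite !inE !negb_or => _ _.
apply: (@leq_trans #|v |: [set u; w]|).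
  by rewrite cardsU1 cards2 uw !inE (negPf vNu) (negPf vNw).
apply/subset_leq_card/subsetP => z; rewrite !inE => /or3P[] /eqP-> //.
  by rewrite -(root_noncut vu).
by rewrite -(root_noncut vw).
Qed.

Let uncut := [set r in roots H | [exists v, (rt v == r) && (cut_at v == set0)]].

(* If there were five, five uncut vertices from different components would
   have total degree at most |V| - 5; averaging over the 4-subsets contradicts
   the degree condition. *)
Lemma uncut_comps_le4 :
    (forall S : {set V}, independent e S -> #|S| = 4 ->
       4 * #|V| <= 5 * (\sum_(s in S) deg e s) + 19) ->
  #|uncut| <= 4.
Proof.
move=> sig; rewrite leqNgt; apply/negP => /card_geqP[s [sU s5 sI]].
pose w r := odflt r [pick v | (rt v == r) && (cut_at v == set0)].
have wP r : r \in s -> rt (w r) = r /\ cut_at (w r) = set0.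
  move/sI; rewrite inE => /andP[_ /existsP ex]; rewrite /w.
  case: pickP => [v /andP[/eqP ? /eqP] // | no].
  by case: ex => v; rewrite no.
pose R5 := [set r in s]; pose d r := deg e (w r).
have R5c : #|R5| = 5 by rewrite cardsE (card_uniqP sU).
have w_inj : {in R5 &, injective w}.
  by move=> a b; rewrite !inE => /wP[ra _] /wP[rb _] wab; rewrite -ra wab rb.
pose D := \sum_(r in R5) d r.
have le1 r0 : r0 \in R5 -> 4 * #|V| + 5 * d r0 <= 5 * D + 19.
  move=> r0s; have sub a : a \in R5 :\ r0 -> a \in R5 by case/setD1P.
  have w_inj' : {in R5 :\ r0 &, injective w}.
    by move=> a b /sub aR /sub bR; apply: w_inj.
  have := sig (w @: (R5 :\ r0)); rewrite big_imset //= card_in_imset //.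
  rewrite /D (big_setD1 r0 r0s) /= => le_sig.
  have card4 : #|R5 :\ r0| = 4.
    by have := cardsD1 r0 R5; rewrite R5c r0s => -[].
  suff /le_sig/(_ card4) : independent e [set w x | x in R5 :\ r0].
    by rewrite /d; lia.
  apply/forall_inP => _ /imsetP[a /sub aR ->].
  apply/forall_inP => _ /imsetP[b /sub bR ->]; apply/negP => ab.
  move: aR bR; rewrite !inE => /wP[ra ca] /wP[rb _].
  have abN : [set w a; w b] \notin cut_edges e.
    apply/negP => abC; have := in_set0 [set w a; w b].
    by rewrite -ca inE abC set21.
  have := root_noncut ab abN; rewrite ra rb => aEb.
  by rewrite aEb e_irr in ab.
have le2 : D + 5 <= #|V|.
  rewrite -R5c -sum1_card -big_split /=.
  apply: (@leq_trans (\sum_(r in R5) \sum_(v | rt v == r) 1)).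
    apply: leq_sum => r; rewrite inE => /wP[rr cr].
    by rewrite addn1 /d sum1dep_card -{2}rr deg_uncut.
  rewrite -sum1_card [leqRHS](bigID (fun v => rt v \in R5)) /=.
  rewrite [X in _ <= X + _](partition_big rt (mem R5)) //=.
  apply: leq_trans (leq_addr _ _); apply: leq_sum => r rR.
  by apply/eq_leq/eq_bigl => v; case: eqP => [->|]; rewrite ?andbF ?andbT.
(* Summing [le1] over the five choices of [r0] gives [20 * #|V| <= 20 * D + 95], against
   [D + 5 <= #|V|]. *)
have := leq_sum (index_enum V) le1; rewrite big_split /= !sum_nat_const R5c.
by rewrite -big_distrr /= -/D; move: D #|V| le2 {le1} => D N; lia.
Qed.

Let W := [set v | #|cut_at v| == 2].

Lemma card_W_cut_edges (f : {set V}) : f \in cut_edges e ->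
    (forall v, #|cut_at v| <= 2 < deg e v) -> #|uncut| <= 4 ->
  #|W| + #|cut_edges e| <= 5.
Proof.
move=> fC cd uncut4; have [a [b [ab fab]]] := edgeE (subsetP cut_edges_sub f fC).
have aNb : rt a != rt b.
  rewrite root_connect; last exact: adj_csym.
  move: (fC); rewrite fab mem_cut // -fab; apply: contra.
  apply: connectS; apply/subsetP => g; rewrite in_setD in_setD1 => /andP[gN ->].
  by rewrite andbT; apply: contraNneq gN => ->.
pose c r := \sum_(v | rt v == r) #|cut_at v|.
pose m r := \sum_(v | rt v == r) (#|cut_at v| == 2 : nat).
(* One inequality for both excesses, 1 and 3: being uncut is worth 2. *)
have key r : roots H r -> m r + 3 <= c r + ((r \in uncut) + (r \in uncut)).
  move=> /[dup] rr /eqP rrE; have [rU | rNU] := boolP (r \in uncut).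
    suff: 0 < c r.
      have : 2 * m r <= c r; last by lia.
      rewrite /m big_distrr /=; apply: leq_sum => v _.
      by case: eqP => // ->.
    (* The ends of [f] lie in different components, so some edge leaves the component of [r], and it
       is a cut-edge. *)
    have [z zNr] : exists z, rt z != r.
      by case: (eqVneq (rt a) r) aNb => [-> | ]; [exists b; rewrite eq_sym | exists a].
    have [s [t [st /eqP rs rt']]] :=
      connect_crossing (e_conn r z) (X := fun v => rt v == r) rr zNr.
    have stC : [set s; t] \in cut_edges e.
      by apply: contraR rt' => /(root_noncut st) <-; rewrite rs.
    rewrite /c (bigD1 s) ?rs //= addn_gt0; apply/orP; left.
    by apply/card_gt0P; exists [set s; t]; rewrite inE stC set21.
  (* Here each vertex is on one or two cut-edges, and [m r] counts the second ones. *)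
  have -> : c r = #|[set v | rt v == r]| + m r.
    rewrite -sum1dep_card -big_split /=; apply: eq_bigr => v vr.
    have : cut_at v != set0.
      apply: contra rNU => v0; rewrite inE; apply/andP; split=> //.
      by apply/existsP; exists v; rewrite vr.
    rewrite -card_gt0; have /andP[] := cd v.
    by case: #|_| => [|[|[]]].
  have /andP[cr dr] := cd r; have := comp_card_ge3 (leq_ltn_trans cr dr).
  by rewrite -/rt /rt rrE; lia.
have := leq_sum (index_enum V) key; rewrite !big_split /=.
have all_roots (F : V -> nat) :
    \sum_(r | roots H r) \sum_(v | rt v == r) F v = \sum_v F v.
  rewrite [RHS](partition_big rt (roots H)) // => v _.
  by apply: roots_root; apply: adj_csym.
rewrite /m /c !all_roots sum_cut_at.
have -> : \sum_v (#|cut_at v| == 2 : nat) = #|W|.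
  by rewrite -sum1dep_card [RHS]big_mkcond; apply: eq_bigr => v _; case: ifP.
have -> : \sum_(r | roots H r) (r \in uncut : nat) = #|uncut|.
  rewrite -sum1_card big_mkcond [RHS]big_mkcond; apply: eq_bigr => v _.
  have [|_] := boolP (v \in uncut); last by rewrite if_same.
  by rewrite inE => /andP[rv _]; rewrite ifT.
have -> : \sum_(r | roots H r) 3 = 3 * n_comp H V.
  rewrite sum_nat_const mulnC; congr (3 * _); apply: eq_card => v.
  by rewrite !inE andbT.
(* The sum reads [w + 3 * r <= 2 * k + 2 * u] in the names introduced below; with [k < r] and
   [u <= 4] this gives [w + k + 3 <= 8]. *)
have := card_cut_lt a (subxx (cut_edges e)); rewrite -/H.
move: #|W| #|cut_edges e| (n_comp H V) #|uncut| uncut4 => w k r u.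
by lia.
Qed.

Lemma common_cut_edge :
    (forall v, #|cut_at v| <= 2 < deg e v) -> #|uncut| <= 4 ->
    W != set0 ->
  exists2 f, f \in cut_edges e & forall v, v \in W -> f \in cut_at v.
Proof.
move=> cd uncut4 /set0Pn[a aW]; have := aW; rewrite inE => /eqP a2.
have /card_gt0P[f fa] : 0 < #|cut_at a| by rewrite a2.
have fC : f \in cut_edges e by move: fa; rewrite inE => /andP[].
have le5 := card_W_cut_edges fC cd uncut4.
have leWC : #|W| <= #|cut_edges e|.
  rewrite -(leq_pmul2l (isT : 0 < 2)) -sum_cut_at -sum1_card big_distrr /=.
  rewrite big_mkcond; apply: leq_sum => v _; rewrite inE.
  by case: eqP => // ->.
have [W1 | [b]] := set_0Vmem (W :\ a).
  exists f => // v vW; have : v \notin W :\ a by rewrite W1 inE.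
  by rewrite in_setD1 vW andbT negbK => /eqP->.
case/setD1P=> ba bW; have := bW; rewrite inE => /eqP b2.
have cW : 2 = #|[set a; b]| by rewrite cards2 eq_sym ba.
have Wab : W = [set a; b].
  apply/esym/eqP; rewrite eqEcard -cW; apply/andP; split; last by lia.
  by apply/subsetP => v /set2P[]->.
(* Two pairs among at most three cut-edges meet. *)
have : 0 < #|cut_at a :&: cut_at b|.
  have := cardsUI (cut_at a) (cut_at b); rewrite a2 b2.
  have : #|cut_at a :|: cut_at b| <= #|cut_edges e|.
    apply/subset_leq_card/subsetP => g.
    by rewrite !inE -andb_orr => /andP[].
  by move: le5; rewrite Wab -cW; lia.
case/card_gt0P => g /setIP[ga gb].
exists g; first by move: ga; rewrite inE => /andP[].
by move=> v; rewrite Wab => /set2P[]->.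
Qed.

Lemma cfc2 : ~ complete e ->
    (forall v, #|cut_at v| <= 2 < deg e v) ->
    (forall S : {set V}, independent e S -> #|S| = 4 ->
       4 * #|V| <= 5 * (\sum_(s in S) deg e s) + 19) ->
  cfc e 2.
Proof.
move=> ncomp cd sig; split; last by move=> j; apply: cfc_ge2.
have inW f g w : f \in cut_at w -> g \in cut_at w -> f != g ->
    w \in W /\ cut_at w = [set f; g].
  move=> fw gw fg; have sub : [set f; g] \subset cut_at w.
    by apply/subsetP => h /set2P[]->.
  have c2 : #|[set f; g]| = 2 by rewrite cards2 fg.
  have /andP[le2 _] := cd w.
  split; last by apply/esym/eqP; rewrite eqEcard sub c2.
  by rewrite inE eqn_leq le2 -c2 subset_leq_card.
have [W0 | Wn0] := eqVneq W set0.
  (* No two cut-edges are adjacent; the empty set serves as a non-edge. *)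
  apply: (@cf_colourable2 set0) => [/card_edge | f g w fw gw fg].
    by rewrite cards0.
  by have [] := inW _ _ _ fw gw fg; rewrite W0 inE.
have [f0 f0C f0W] := common_cut_edge cd (uncut_comps_le4 sig) Wn0.
apply: (@cf_colourable2 f0) => // f g w fw gw fg.
by have [wW <-] := inW _ _ _ fw gw fg; apply: f0W.
Qed.

End CutEdges.

(** * From the degree hypotheses to inequalities in [nat] *)

Import Order.TTheory GRing.Theory Num.Theory.

Lemma sigma_le (V : finType) (e : rel V) (S : {set V}) (k : nat) (q : rat) :
  independent e S -> #|S| = k -> (q%:E <= sigma e k)%E ->
  (q <= (\sum_(s in S) deg e s)%:R)%R.
Proof.
move=> indS cS qle; rewrite -lee_fin (le_trans qle) //.
by apply: bigmin_le_cond; rewrite indS cS eqxx.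
Qed.

Lemma min_deg_le (V : finType) (e : rel V) v : min_deg e <= deg e v.
Proof. exact: (bigmin_le (#|V| : nat) v (deg e)). Qed.

Theorem theorem7 (n : nat) (V : finType) (e : rel V)
    (e_sym : symmetric e) (e_irr : irreflexive e)
    (n_ge21 : 21 <= n)
    (order_n : #|V| = n)
    (G_conn : connected e)
    (G_noncomplete : ~ complete e)
    (G_min_deg : 3 <= min_deg e)
    (G_cut : linear_forest (cut_verts e) (cut_adj e))
    (G_sigma4 : (((4%:R * n%:R - 19%:R) / 5%:R : rat)%R%:E <= sigma e 4)%E) :
  cfc e 2.
Proof.
apply: cfc2 => // [v | S indS S4].
  by rewrite cut_at_le2 // (leq_trans G_min_deg (min_deg_le e v)).
(* The denominator is cleared and 19 moved across, which avoids truncated subtraction. *)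
have := sigma_le indS S4 G_sigma4.
rewrite order_n ler_pdivrMr ?ltr0n // lerBlDr -!natrM -natrD ler_nat.
by rewrite [5 * _]mulnC.
Qed.
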